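(* Fix $\epsilon>0$ and $\alpha\le \frac12-\epsilon$. For all sufficiently large $n$, every randomized simultaneous protocol for bipartite matching with $n$ players and $n$ items in which each player sends a message of at most $l\le n^{\frac12-\alpha-\frac{\epsilon}{2}}$ bits has approximation ratio no better than $n^{\alpha}$; that is, if the protocol has approximation ratio $c$, then $c\ge n^{\alpha}$.
   Context: Bipartite matching problem: there are $n$ players and $n$ items. Player $i$ privately knows a set $S_i$ of items (his neighbor set in a bipartite graph). In a deterministic simultaneous protocol with $l$ bits per player, each player $i$ sends to a central planner one message of at most $l$ bits that is a function of $S_i$ only; the planner, based only on the $n$ messages, outputs a vector $(a_1,\dots,a_n)$ in which each $a_i$ is an item (or ''nothing'') and no item is assigned to two players. The value of the output is $|\{i : a_i\in S_i\}|$. A randomized simultaneous protocol is a probability distribution over deterministic simultaneous protocols. $OPT$ denotes the size of a maximum matching. A randomized protocol has approximation ratio $c\ge1$ if on every input $(S_1,\dots,S_n)$ the expected value of its output is at least $OPT/c$. *)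

(* Defs.v *)
From mathcomp Require Import all_boot all_order all_algebra.
From mathcomp Require Import reals exp.

Set Implicit Arguments.
Unset Strict Implicit.
Unset Printing Implicit Defensive.

Import Order.TTheory GRing.Theory Num.Theory.
Local Open Scope ring_scope.

(* Player i's private input is the set [S i] of neighbouring items. *)
Definition input (n : nat) : Type := 'I_n -> {set 'I_n}.

(* [(i, x) \in M] matches player i with item x. *)
Definition is_matching (n : nat) (S : input n) (M : {set 'I_n * 'I_n}) : bool :=
  [forall e in M, e.2 \in S e.1] &&
  [forall e in M, forall f in M,
     (e != f) ==> ((e.1 != f.1) && (e.2 != f.2))].

Definition OPT (n : nat) (S : input n) : nat :=
  (\max_(M : {set 'I_n * 'I_n} | is_matching S M) #|M|)%N.

(* [None] means that the player receives nothing; no edge of the input graph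
   is required between a player and the item assigned to him. *)
Definition is_assignment (n : nat) (a : {ffun 'I_n -> option 'I_n}) : bool :=
  [forall i, forall j, (i != j) ==> (a i != None) ==> (a i != a j)].

Definition assignment (n : nat) : finType :=
  {a : {ffun 'I_n -> option 'I_n} | is_assignment a}.

Definition value (n : nat) (S : input n) (a : assignment n) : nat :=
  #|[set i | [exists x in S i, sval a i == Some x]]|.

(* Bit strings of length at most l. *)
Definition message (l : nat) : finType := l.-bseq bool.

(* The players' message functions, paired with the planner's decision rule.
   This type is finite, so that a distribution over deterministic protocols is
   just a family of weights. *)
Definition det_protocol (n l : nat) : finType :=
  ({ffun 'I_n -> {ffun {set 'I_n} -> message l}} *
   {ffun {ffun 'I_n -> message l} -> assignment n})%type.

Definition output (n l : nat) (p : det_protocol n l) (S : input n) :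
    assignment n :=
  p.2 [ffun i => p.1 i (S i)].

Record rand_protocol (R : realType) (n l : nat) := RandProtocol {
  weight :> det_protocol n l -> R;
  weight_ge0 : forall p, 0 <= weight p;
  weight_sum1 : \sum_p weight p = 1
}.

Definition expected_value (R : realType) (n l : nat)
    (P : rand_protocol R n l) (S : input n) : R :=
  \sum_p P p * (value S (output p S))%:R.

Definition has_approx_ratio (R : realType) (n l : nat)
    (P : rand_protocol R n l) (c : R) : Prop :=
  1 <= c /\ forall S : input n, (OPT S)%:R / c <= expected_value P S.

(* Main.v *)
Require Import Defs.
From mathcomp Require Import all_boot all_order all_algebra.
From mathcomp Require Import reals exp.
From mathcomp Require Import ring lra zify.
Import Order.TTheory GRing.Theory Num.Theory.
Local Open Scope ring_scope.

Set Implicit Arguments.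
Unset Strict Implicit.
Unset Printing Implicit Defensive.

(* Averaging over a random input reduces to deterministic protocols. Arrange
   the items in a grid with f columns, f of order n^(1 - alpha), and r = n / f
   rows. A random pair of items is marked in every column, and all players
   share these 2f items, except that each player has a hidden random column in
   which a private random pair replaces the shared one. A player's set consists
   of a random one of the two items of each pair that he faces. The items that
   come from the private pairs give OPT at least f r / 2 on average, while the
   shared items contribute at most 2f to the value.

   It remains to bound the probability that a player is assigned his private
   item. In his hidden column, exchange the shared pair and the private pair:
   the player's set then picks one item out of each of f pairs, and the planner
   may be assumed to know everything except the pair in the hidden column. For
   a fixed message, let H be the number of columns j such that the planner,
   were j hidden, would assign the picked item of j, and H' the number of those
   where he would assign the other item of the pair. The picks are independent
   fair bits and (3/2 + (3/2)^(-2)) / 2 < 1, hence (3/2)^(H - 2H') has mean at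
   most 1. Summing over the 2^(l + 1) possible messages, by convexity,
   E H <= 2 E H' + 2 (l + 1). Finally E H' <= f / r, as the planner and the
   message do not depend on the item that is not picked. The hidden column is
   uniform, so the probability is at most 2 / r + 2 (l + 1) / f. *)

(** * Replacing one coordinate of a random function *)

Definition upd (I : finType) (X : Type) (w : {ffun I -> X}) (i : I) (x : X) :
    {ffun I -> X} :=
  [ffun k => if k == i then x else w k].

Lemma upd_eq (I : finType) (X : Type) (w : {ffun I -> X}) (i : I) (x : X) :
  upd w i x i = x.
Proof. by rewrite ffunE eqxx. Qed.

Lemma upd_upd (I : finType) (X : Type) (w : {ffun I -> X}) (i : I) (x y : X) :
  upd (upd w i x) i y = upd w i y.
Proof. by apply/ffunP => k; rewrite !ffunE; case: eqP. Qed.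

Lemma upd_id (I : finType) (X : Type) (w : {ffun I -> X}) (i : I) :
  upd w i (w i) = w.
Proof. by apply/ffunP => k; rewrite !ffunE; case: eqP => [->|]. Qed.

(** Exchanging [x] with the coordinate [w i] is an involution on the pairs [(w, x)]. *)
Lemma sum_upd_swap (V : nmodType) (I X : finType) (i : I)
    (H : {ffun I -> X} -> X -> V) :
  \sum_w \sum_x H w x = \sum_w \sum_x H (upd w i x) (w i).
Proof.
rewrite !pair_big /=.
pose h (p : {ffun I -> X} * X) := (upd p.1 i p.2, p.1 i).
have hK : involutive h.
  by case=> w x; rewrite /h /= upd_eq upd_upd upd_id.
by rewrite (reindex_inj (inv_inj hK)).
Qed.

Lemma sum_upd (V : nmodType) (I X : finType) (i : I) (H : {ffun I -> X} -> V) :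
  (\sum_w H w) *+ #|X| = \sum_w \sum_x H (upd w i x).
Proof.
rewrite (sum_upd_swap i) -sumrMnl; apply: eq_bigr => w _.
by under eq_bigr => x _ do rewrite upd_upd upd_id; rewrite sumr_const.
Qed.

(** * Exponential moments of the number of correct guesses *)

(** Bernoulli's inequality for (3/2)^(a - b), split by the sign of a - b; it turns a bound on an
    exponential moment into one on a mean. *)
Lemma half_linear_le_expr (R : realFieldType) (a b : nat) :
  1 + (a%:R - b%:R) / 2 <= (3 / 2) ^+ a * (2 / 3) ^+ b :> R.
Proof.
have bern : forall k, 1 + k%:R / 2 <= (3 / 2) ^+ k :> R.
  elim=> [|k IH]; first by rewrite expr0; lra.
  have := ler0n R k; rewrite exprS -[k.+1%:R]natr1; lra.
have bern' : forall k, 1 - k%:R / 2 <= (2 / 3) ^+ k :> R.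
  move=> k; apply: (@le_trans _ _ (1 - k%:R / 3)); first by have := ler0n R k; lra.
  elim: k => [|k IH]; first by rewrite expr0; lra.
  have := ler0n R k; rewrite exprS -[k.+1%:R]natr1; lra.
have inv k : (3 / 2) ^+ k * (2 / 3) ^+ k = 1 :> R.
  by rewrite -exprMn (_ : 3 / 2 * (2 / 3) = 1 :> R) ?expr1n //; field.
have [ab|/ltnW ba] := leqP a b.
  rewrite -(subnKC ab) exprD mulrA inv mul1r natrD.
  by have := bern' (b - a)%N; lra.
rewrite -(subnKC ba) exprD mulrAC inv mul1r natrD.
by have := bern (a - b)%N; lra.
Qed.

(* [b j] picks one of the two items of column [j]; [hit m j x] says that item
   [x] of column [j] is the one guessed there after message [m]. *)
Lemma sum_hit_le (R : realFieldType) (I T : finType) (w : nat)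
    (M : {ffun I -> bool} -> T) (hit : T -> I -> bool -> bool) :
  (#|T|%:R <= (3 / 2) ^+ w :> R) ->
  \sum_b \sum_j (hit (M b) j (b j))%:R <=
  \sum_b (w%:R + 2 * \sum_j (hit (M b) j (~~ b j))%:R) :> R.
Proof.
move=> Tw.
(* This is (3/2)^(H - 2H') for a message [m] that does not depend on [b]. *)
pose E m (b : {ffun I -> bool}) : R :=
  \prod_j ((3 / 2) ^+ hit m j (b j) * (2 / 3) ^+ (2 * hit m j (~~ b j))%N).
have E0 m b : 0 <= E m b.
  by apply: prodr_ge0 => j _; rewrite mulr_ge0 // exprn_ge0 //; lra.
have sumE m : \sum_b E m b <= 2 ^+ #|I|.
  rewrite -(bigA_distr_bigA (fun j (x : bool) => (3 / 2) ^+ hit m j x *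
     (2 / 3) ^+ (2 * hit m j (~~ x))%N)) /=.
  rewrite -prodr_const; apply: ler_prod => j _; rewrite big_bool /=.
  apply/andP; split; first by rewrite addr_ge0 // mulr_ge0 // exprn_ge0 //; lra.
  (* With zero, one or two of the items guessed, the two picks sum to 2, 35/18 or 4/3. *)
  by case: (hit m j true); case: (hit m j false); rewrite /= ?expr0 ?expr1 ?muln1 ?muln0 ?expr2; lra.
(* The message actually sent is one of the terms, so summing over all [m] removes its dependence on
   [b]; [(2 / 3) ^+ w] pays for the number of messages. *)
have pt b : 1 + (\sum_j (hit (M b) j (b j))%:R -
    (w%:R + 2 * \sum_j (hit (M b) j (~~ b j))%:R)) / 2 <=
    \sum_m E m b * (2 / 3) ^+ w.
  rewrite (bigD1 (M b)) //= -[leLHS]addr0; apply: lerD; last first.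
    by apply: sumr_ge0 => m _; rewrite mulr_ge0 // exprn_ge0 //; lra.
  have := half_linear_le_expr R (\sum_j hit (M b) j (b j))
            (\sum_j (2 * hit (M b) j (~~ b j))%N + w).
  rewrite natrD !natr_sum exprD mulrA -!prodrXr -big_split /= mulr_sumr.
  by under [X in _ - (X + _)]eq_bigr => j _ do rewrite natrM; rewrite [w%:R + _]addrC.
have := ler_sum (index_enum _) (P := xpredT) (fun b _ => pt b).
rewrite big_split /= -mulr_suml sumrB sumr_const card_ffun card_bool [X in _ <= X]exchange_big /=.
have : \sum_m \sum_b E m b * (2 / 3) ^+ w <= 2 ^+ #|I| :> R.
  under eq_bigr => m _ do rewrite -mulr_suml.
  rewrite -mulr_suml; apply: (@le_trans _ _ (#|T|%:R * 2 ^+ #|I| * (2 / 3) ^+ w)).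
    apply: ler_wpM2r; first by rewrite exprn_ge0 //; lra.
    by apply: (le_trans (ler_sum _ _)) => [m _|]; [exact: sumE|rewrite sumr_const mulr_natl].
  rewrite mulrAC -[leRHS]mul1r ler_wpM2r ?exprn_ge0 //.
  rewrite -[leRHS](_ : (3 / 2) ^+ w * (2 / 3) ^+ w = 1 :> R); last first.
    by rewrite -exprMn (_ : 3 / 2 * (2 / 3) = 1 :> R) ?expr1n //; field.
  by rewrite ler_wpM2r // exprn_ge0 //; lra.
rewrite natrX; lra.
Qed.

Lemma sum_constE (R : pzSemiRingType) (T : finType) (c : R) :
  \sum_(x : T) c = #|T|%:R * c.
Proof. by rewrite sumr_const mulr_natl. Qed.

(** * How often one player receives his private item *)

Definition sel (A : Type) (p : A * A) (b : bool) : A := if b then p.2 else p.1.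

Definition select (J : finType) (A : Type) (rho : {ffun J -> A * A})
    (b : {ffun J -> bool}) : {ffun J -> A} :=
  [ffun j => sel (rho j) (b j)].

Lemma select_upd (J : finType) (A : Type) (rho : {ffun J -> A * A})
    (b : {ffun J -> bool}) (j : J) (p : A * A) :
  select (upd rho j p) b = upd (select rho b) j (sel p (b j)).
Proof. by apply/ffunP => k; rewrite !ffunE; case: eqP => [->|]. Qed.

(** Redraw the pair at [j]: the guess depends only on its picked item, so each picked item leaves at
    most one value for the other, and at most [#|A|] of all pairs count. *)
Lemma unread_hits_le (R : realFieldType) (J A T : finType) (Y : eqType)
    (M : {ffun J -> A} -> T) (G : {ffun J -> A * A} -> T -> Y)
    (enc : J * A -> Y) (j : J) (v : A * A) (b : {ffun J -> bool}) :
  injective enc -> (0 < #|A|)%N ->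
  #|A|%:R * \sum_rho (G (upd rho j v) (M (select rho b)) ==
                      enc (j, sel (rho j) (~~ b j)))%:R <=
  #|{ffun J -> A * A}|%:R :> R.
Proof.
move=> encI A0; have {A0} A0 : 0 < #|A|%:R :> R by rewrite ltr0n.
set H := fun rho : {ffun J -> A * A} => _.
rewrite -(ler_pM2l A0) mulrA -natrM -card_prod mulr_natl (sum_upd j) mulrC.
rewrite mulr_natl -sumr_const; apply: ler_sum => rho _.
rewrite /H -natr_sum ler_nat.
under eq_bigr => p _ do rewrite upd_upd upd_eq select_upd.
pose Q (p : A * A) := G (upd rho j v) (M (upd (select rho b) j (sel p (b j)))) ==
  enc (j, sel p (~~ b j)).
rewrite (_ : (\sum_p _)%N = #|[set p | Q p]|); last first.
  by rewrite -sum1dep_card [RHS]big_mkcond; apply: eq_bigr => p _; rewrite /Q; case: ifP.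
set D := [set p | _].
rewrite -(@card_in_imset _ _ (fun p => sel p (b j)) D) ?max_card //.
move=> p q; rewrite !inE => /eqP Dp /eqP Dq pq.
move: Dp; rewrite pq Dq => /encI [].
by case: p q pq {Dq} => p1 p2 [q1 q2]; rewrite /sel; case: (b j) => /= -> ->.
Qed.

Lemma player_hits_le (R : realFieldType) (J A T : finType) (Y : eqType) (w : nat)
    (M : {ffun J -> A} -> T) (G : {ffun J -> A * A} -> T -> Y)
    (enc : J * A -> Y) :
  injective enc -> (0 < #|A|)%N -> #|T|%:R <= (3 / 2) ^+ w :> R ->
  #|A|%:R * \sum_rho \sum_j \sum_v \sum_b
    (G rho (M (select (upd rho j v) b)) == enc (j, sel v (b j)))%:R <=
  #|{ffun J -> A * A}|%:R * #|{: A * A}|%:R * #|{ffun J -> bool}|%:R *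
    (w%:R * #|A|%:R + 2 * #|J|%:R) :> R.
Proof.
move=> encI A0 Tw.
rewrite exchange_big /=.
under eq_bigr => j _.
  (* After this exchange the message depends on [rho] and [b] but not on the hidden column [j], and
     the planner sees [upd rho j v]. *)
  rewrite (sum_upd_swap j).
  under eq_bigr => rho _ do under eq_bigr => v _ do rewrite upd_upd upd_id.
  over.
rewrite exchange_big /=.
under eq_bigr => rho _ do rewrite exchange_big /=.
under eq_bigr => rho _ do under eq_bigr => v _ do rewrite exchange_big /=.
pose U rho v b j := G (upd rho j v) (M (select rho b)) == enc (j, sel (rho j) (~~ b j)).
apply: (@le_trans _ _ (#|A|%:R * \sum_rho \sum_v \sum_b
    (w%:R + 2 * \sum_j (U rho v b j)%:R))).
  apply: ler_wpM2l; first exact: ler0n.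
  apply: ler_sum => rho _; apply: ler_sum => v _.
  exact: (sum_hit_le (fun b => M (select rho b))
    (fun m j x => G (upd rho j v) m == enc (j, sel (rho j) x))).
have -> : \sum_rho \sum_v \sum_b (w%:R + 2 * \sum_j (U rho v b j)%:R) =
   #|{ffun J -> A * A}|%:R * #|{: A * A}|%:R * #|{ffun J -> bool}|%:R * w%:R +
   2 * \sum_v \sum_b \sum_j \sum_rho (U rho v b j)%:R :> R.
  transitivity (\sum_(v : A * A) \sum_(b : {ffun J -> bool})
     (#|{ffun J -> A * A}|%:R * w%:R + 2 * \sum_j \sum_rho (U rho v b j)%:R) : R).
    rewrite exchange_big /=; apply: eq_bigr => v _.
    rewrite exchange_big /=; apply: eq_bigr => b _.
    by rewrite big_split /= sum_constE -mulr_sumr exchange_big.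
  under eq_bigr => v _ do rewrite big_split /= sum_constE -mulr_sumr.
  by rewrite big_split /= sum_constE -mulr_sumr; congr (_ + _); ring.
have : #|A|%:R * \sum_v \sum_b \sum_j \sum_rho (U rho v b j)%:R <=
   #|{ffun J -> A * A}|%:R * #|{: A * A}|%:R * #|{ffun J -> bool}|%:R * #|J|%:R :> R.
  have -> : #|{ffun J -> A * A}|%:R * #|{: A * A}|%:R * #|{ffun J -> bool}|%:R * #|J|%:R =
     \sum_(v : A * A) \sum_(b : {ffun J -> bool}) \sum_(j : J) #|{ffun J -> A * A}|%:R :> R.
    by rewrite !sum_constE; ring.
  rewrite mulr_sumr; apply: ler_sum => v _.
  rewrite mulr_sumr; apply: ler_sum => b _.
  rewrite mulr_sumr; apply: ler_sum => j _.
  exact: (unread_hits_le R M G j v b encI A0).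
move: (\sum_v _) => s; lra.
Qed.

(** * Lower bounds on the maximum matching *)

(** For each item of the image, [pick] retains a single player with that value of [y]. *)
Lemma card_image_le_OPT (n : nat) (S : input n) (y : 'I_n -> 'I_n) :
  (forall i, y i \in S i) -> (#|[set y i | i : 'I_n]| <= OPT S)%N.
Proof.
move=> yS.
pose M := [set e : 'I_n * 'I_n | [pick i | y i == e.2] == Some e.1].
have yM e : e \in M -> y e.1 = e.2.
  by rewrite inE; case: pickP => // i /eqP <- /eqP [<-].
have MS : is_matching S M.
  apply/andP; split; first by apply/forall_inP => e /yM <-.
  apply/forall_inP => e eM; apply/forall_inP => e' e'M; apply/implyP => ee'.
  apply/andP; split; apply: contra_neq ee' => E.
    by rewrite [e]surjective_pairing [e']surjective_pairing -!yM // E.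
  move: eM e'M; rewrite !inE E => /eqP -> /eqP [E'].
  by rewrite [e]surjective_pairing [e']surjective_pairing E E'.
apply: (@leq_trans #|M|); last exact: leq_bigmax_cond.
apply: leq_trans (leq_imset_card snd M); apply: subset_leq_card.
apply/subsetP => z /imsetP [i _ ->]; apply/imsetP.
case E: [pick k | y k == y i] => [k|]; first by exists (k, y i); rewrite ?inE ?E.
by move: E; case: pickP => // /(_ i); rewrite eqxx.
Qed.

Lemma double_expn_pred (N n : nat) : (0 < N <= n)%N -> (2 * N.-1 ^ n <= N ^ n)%N.
Proof.
case: N => // m /= mn.
have bern p : (m ^ p.+1 + p.+1 * m ^ p <= m.+1 ^ p.+1)%N.
  elim: p => [|p IH]; first by rewrite !expn1 expn0; lia.
  rewrite [leqRHS]expnS; apply: leq_trans (leq_mul (leqnn _) IH).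
  by rewrite !expnS; nia.
case: n mn => // n mn; apply: leq_trans (bern n).
by rewrite mul2n -addnn leq_add2l expnS leq_mul2r; apply/orP; right; lia.
Qed.

(** Equal fibres make [u (w i)] uniform on [Y], so a given [y] is missed with probability (1 -
    1/|Y|)^n, which is at most 1/2 by [double_expn_pred]. *)
Lemma sum_card_image_ge (n k : nat) (X Y : finType) (u : X -> Y) :
  (forall y, #|[pred x | u x == y]| = k) -> (#|Y| <= n)%N ->
  (#|Y| * #|X| ^ n <= 2 * \sum_(w : {ffun 'I_n -> X}) #|[set u (w i) | i : 'I_n]|)%N.
Proof.
move=> uk Yn.
have cX : #|X| = (#|Y| * k)%N.
  rewrite -sum1_card (partition_big u xpredT) //= -sum_nat_const.
  by apply: eq_bigr => y _; rewrite -(uk y) -sum1_card.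
have -> : (\sum_(w : {ffun 'I_n -> X}) #|[set u (w i) | i : 'I_n]| =
    \sum_y #|[set w : {ffun 'I_n -> X} | y \in [set u (w i) | i : 'I_n]]|)%N.
  transitivity (\sum_(w : {ffun 'I_n -> X}) \sum_y (y \in [set u (w i) | i : 'I_n]))%N.
    by apply: eq_bigr => w _; rewrite -sum1_card big_mkcond; apply: eq_bigr => y _; case: ifP.
  rewrite exchange_big; apply: eq_bigr => y _.
  by rewrite -sum1_card [RHS]big_mkcond; apply: eq_bigr => w _; rewrite [in RHS]inE; case: ifP.
rewrite -sum_nat_const big_distrr /=; apply: leq_sum => y _.
set B := [set w | _].
have cB : #|~: B| = ((#|Y| * k - k) ^ n)%N.
  rewrite -cX -(uk y) -[X in (_ ^ X)%N]card_ord.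
  have -> : (#|X| - #|[pred x | u x == y]|)%N = #|[pred x | u x != y]|.
    by rewrite -(cardC [pred x | u x == y]) addKn.
  rewrite -card_ffun_on; apply: eq_card => w; rewrite !inE.
  apply/idP/ffun_onP => [yw i|yw].
    by rewrite inE; apply: contra yw => /eqP <-; exact: imset_f.
  by apply/imsetP => -[i _ yi]; have := yw i; rewrite inE -yi eqxx.
have := cardsC B; rewrite cB card_ffun card_ord => cBX.
have Y0 : (0 < #|Y|)%N by apply/card_gt0P; exists y.
have := @double_expn_pred #|Y| n; rewrite Y0 Yn => /(_ isT) H.
have : (2 * (#|Y| * k - k) ^ n <= #|X| ^ n)%N.
  rewrite cX (_ : #|Y| * k - k = #|Y|.-1 * k)%N; last by rewrite -subn1 mulnBl mul1n.
  by rewrite !expnMn mulnA leq_mul2r H orbT.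
by rewrite -cBX !mul2n -!addnn leq_add2r leq_add2l.
Qed.

(** * The hard distribution *)

(* The private randomness [(j, v, b)] of a player: hidden column, private pair,
   and choices within the pairs. *)
Definition draw (J A : finType) : finType := (J * (A * A) * {ffun J -> bool})%type.

Definition own (J A : finType) (x : draw J A) : J * A :=
  (x.1.1, sel x.1.2 (x.2 x.1.1)).

Definition items (n : nat) (J A : finType) (enc : J * A -> 'I_n)
    (t : {ffun J -> A}) : {set 'I_n} := [set enc (j, t j) | j : J].

Definition hard_input (n : nat) (J A : finType) (enc : J * A -> 'I_n)
    (rho : {ffun J -> A * A}) (w : {ffun 'I_n -> draw J A}) : input n :=
  fun i => items enc (select (upd rho (w i).1.1 (w i).1.2) (w i).2).

(** Once the private item is fixed, the choice bits and the other item of the private pair remain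
    free. *)
Lemma own_fiber (J A : finType) (y : J * A) :
  #|[pred x : draw J A | own x == y]| = (2 ^ #|J| * #|A|)%N.
Proof.
case: y => j a.
pose h (z : {ffun J -> bool} * A) : draw J A :=
  (j, if z.1 j then (z.2, a) else (a, z.2), z.1).
have hI : injective h.
  case=> b c [b' c'] E; have /= Eb := congr1 snd E; move: E; rewrite -{}Eb => E.
  by have /= := congr1 (fun x : draw J A => x.1.2) E; case: (b j) => Ec; congruence.
have -> : (2 ^ #|J| * #|A|)%N = #|{: {ffun J -> bool} * A}|.
  by rewrite card_prod card_ffun card_bool.
rewrite -cardsT -(card_imset _ hI); apply: eq_card => -[[j' v] b]; rewrite !inE.
rewrite /own /=; apply/eqP/imsetP => [[Ej Ea]|[[b' c] _ [-> -> ->]]].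
  exists (b, sel v (~~ b j)) => //.
  by rewrite /h /= -Ea Ej /sel; case: v {Ea}; case: (b j).
by rewrite /sel; case: (b' j).
Qed.

Lemma own_in_hard_input (n : nat) (J A : finType) (enc : J * A -> 'I_n)
    (rho : {ffun J -> A * A}) (w : {ffun 'I_n -> draw J A}) (i : 'I_n) :
  enc (own (w i)) \in hard_input enc rho w i.
Proof.
apply/imsetP; exists (w i).1.1 => //.
by rewrite /select ffunE upd_eq.
Qed.

(** An item of his set that a player gets outside his hidden column is one of at most [#|J| * 2]
    shared ones, and no item goes to two players. *)
Lemma value_hard_input_le (n : nat) (J A : finType) (enc : J * A -> 'I_n)
    (rho : {ffun J -> A * A}) (w : {ffun 'I_n -> draw J A}) (a : assignment n) :
  (value (hard_input enc rho w) a <=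
   #|J| * 2 + \sum_i (sval a i == Some (enc (own (w i)))))%N.
Proof.
pose D := [set i | sval a i == Some (enc (own (w i)))].
pose shared (p : J * bool) := Some (enc (p.1, sel (rho p.1) p.2)).
pose B := [set i | sval a i \in shared @: [set: J * bool]].
have -> : (\sum_i (sval a i == Some (enc (own (w i)))))%N = #|D|.
  by rewrite -sum1dep_card [RHS]big_mkcond; apply: eq_bigr => i _; case: ifP.
apply: (@leq_trans #|B :|: D|).
  apply/subset_leq_card/subsetP => i; rewrite !inE => /exists_inP [x].
  move=> /imsetP [j _ ->] /eqP ai; rewrite ai.
  have [->|jw] := eqVneq j (w i).1.1.
    by apply/orP; right; rewrite /select ffunE upd_eq.
  apply/orP; left; apply/imsetP; exists (j, (w i).2 j) => //.
  by rewrite /shared /select ffunE /upd ffunE (negbTE jw).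
rewrite cardsU; apply: leq_trans (leq_subr _ _) _; rewrite leq_add2r.
have aI : {in B &, injective (sval a)}.
  move=> i k; rewrite !inE => iB _ aik; apply/eqP; apply: contraT => ik.
  have /forallP/(_ i)/forallP/(_ k) := valP a.
  rewrite ik /= aik eqxx implybF negbK => /eqP ak.
  by move: iB; rewrite aik ak => /imsetP [].
rewrite -(card_in_imset aI); apply: (@leq_trans #|shared @: [set: J * bool]|).
  by apply/subset_leq_card/subsetP => z /imsetP [i]; rewrite inE => iB ->.
by apply: leq_trans (leq_imset_card _ _) _; rewrite cardsT card_prod card_bool.
Qed.

(** * Averaging over the hard inputs *)

(** There are fewer than 2^(l + 1) messages, and 2 <= (3/2)^2. *)
Lemma card_message_le (R : realFieldType) (l : nat) :
  #|message l|%:R <= (3 / 2) ^+ (2 * l.+1) :> R.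
Proof.
apply: (@le_trans _ _ (2 ^+ l.+1)).
  rewrite -natrX ler_nat card_bseq card_bool.
  elim: l => [|l IH]; first by rewrite big_ord1.
  by rewrite big_ord_recr /= [leqRHS]expnS mul2n -addnn leq_add2r.
by rewrite exprM; apply: lerXn2r; rewrite ?nnegrE ?expr2; lra.
Qed.

Lemma own_hits_le (R : realFieldType) (n l : nat) (J A : finType)
    (enc : J * A -> 'I_n) (p : det_protocol n l) (i : 'I_n) :
  injective enc -> (0 < #|A|)%N ->
  (#|J| * #|A|)%:R * \sum_rho \sum_(w : {ffun 'I_n -> draw J A})
     (sval (output p (hard_input enc rho w)) i == Some (enc (own (w i))))%:R <=
  #|{ffun J -> A * A}|%:R * #|{ffun 'I_n -> draw J A}|%:R *
  ((2 * l.+1 * #|A| + 2 * #|J|)%:R) :> R.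
Proof.
move=> encI A0.
set hit := fun rho w => (sval (output p (hard_input enc rho w)) i == Some (enc (own (w i)))).
have [X0|X0] := posnP #|draw J A|.
  have J0 : #|J| = 0%N.
    case: (posnP #|J|) => // J0.
    suff : (0 < #|draw J A|)%N by rewrite X0.
    by rewrite !card_prod card_ffun card_bool !muln_gt0 J0 A0 expn_gt0.
  by rewrite J0 mul0n mul0r !mulr_ge0.
have {}X0 : 0 < #|draw J A|%:R :> R by rewrite ltr0n.
rewrite -(ler_pM2l X0) mulrCA.
have -> : #|draw J A|%:R * \sum_rho \sum_w (hit rho w)%:R =
    \sum_(w : {ffun 'I_n -> draw J A}) \sum_rho \sum_x (hit rho (upd w i x))%:R :> R.
  rewrite mulr_sumr [RHS]exchange_big; apply: eq_bigr => rho _ /=.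
  by rewrite -(sum_upd i (fun w => (hit rho w)%:R : R)) mulr_natl.
have -> : #|draw J A|%:R * (#|{ffun J -> A * A}|%:R * #|{ffun 'I_n -> draw J A}|%:R *
    (2 * l.+1 * #|A| + 2 * #|J|)%:R) =
    \sum_(w : {ffun 'I_n -> draw J A}) #|draw J A|%:R * (#|{ffun J -> A * A}|%:R *
    (2 * l.+1 * #|A| + 2 * #|J|)%:R) :> R.
  by rewrite sum_constE; ring.
rewrite mulr_sumr; apply: ler_sum => w _.
(* With the other draws frozen in [w], the other messages are functions of [rho], so the planner
   becomes a function of [rho] and the message of player [i]. *)
pose G rho (m : message l) := sval (p.2 [ffun k => if k == i then m
  else p.1 k (hard_input enc rho w k)]) i.
have hitE rho j v b : hit rho (upd w i (j, v, b)) =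
    (G rho (p.1 i (items enc (select (upd rho j v) b))) == Some (enc (j, sel v (b j)))).
  rewrite /hit /G /output upd_eq /own /=; congr (sval (p.2 _) i == _).
  apply/ffunP => k; rewrite !ffunE /hard_input; case: eqP => [->|/eqP ki].
    by rewrite upd_eq.
  by rewrite /upd ffunE (negbTE ki).
have sumE rho : \sum_x (hit rho (upd w i x))%:R = \sum_j \sum_v \sum_b
    (G rho (p.1 i (items enc (select (upd rho j v) b))) == Some (enc (j, sel v (b j))))%:R :> R.
  rewrite pair_bigA /= pair_bigA /=.
  by apply: eq_bigr => -[[j v] b] _; rewrite hitE.
under eq_bigr => rho _ do rewrite sumE.
have SencI : injective (fun z => Some (enc z)) by move=> y z [/encI].
have := @player_hits_le R J A (message l) _ (2 * l.+1) (fun t => p.1 i (items enc t)) G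
  _ SencI A0 (card_message_le R l).
move: (\sum_rho _) => s h.
rewrite natrM -mulrA; apply: (le_trans (ler_wpM2l (ler0n _ _) h)).
by rewrite !card_prod (natrD _ (2 * l.+1 * #|A|)) !natrM le_eqVlt; apply/orP; left; apply/eqP; ring.
Qed.

Lemma sum_value_le (R : realFieldType) (n l : nat) (J A : finType)
    (enc : J * A -> 'I_n) (p : det_protocol n l) :
  injective enc -> (0 < #|A|)%N ->
  (#|J| * #|A|)%:R * \sum_rho \sum_(w : {ffun 'I_n -> draw J A})
     (value (hard_input enc rho w) (output p (hard_input enc rho w)))%:R <=
  #|{ffun J -> A * A}|%:R * #|{ffun 'I_n -> draw J A}|%:R *
  ((#|J| * #|A|) * (#|J| * 2) + n * (2 * l.+1 * #|A| + 2 * #|J|))%:R :> R.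
Proof.
move=> encI A0.
set hit := fun i rho w => (sval (output p (hard_input enc rho w)) i == Some (enc (own (w i)))).
apply: (@le_trans _ _ ((#|J| * #|A|)%:R *
    (#|{ffun J -> A * A}|%:R * #|{ffun 'I_n -> draw J A}|%:R * (#|J| * 2)%:R +
     \sum_i \sum_rho \sum_w (hit i rho w)%:R))).
  apply: ler_wpM2l; first exact: ler0n.
  rewrite [X in _ + X]exchange_big -mulrA -sum_constE -big_split /=; apply: ler_sum => rho _.
  rewrite [X in _ + X]exchange_big -sum_constE -big_split /=; apply: ler_sum => w _.
  by rewrite -natr_sum -natrD ler_nat value_hard_input_le.
rewrite mulrDr [in leRHS]natrD [leRHS]mulrDr; apply: lerD.
  by rewrite natrM le_eqVlt; apply/orP; left; apply/eqP; ring.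
rewrite [leRHS](_ : _ = \sum_(i < n) #|{ffun J -> A * A}|%:R *
  #|{ffun 'I_n -> draw J A}|%:R * (2 * l.+1 * #|A| + 2 * #|J|)%:R); last first.
  by rewrite sum_constE card_ord [(n * _)%:R]natrM mulrCA.
rewrite mulr_sumr.
by apply: ler_sum => i _; exact: own_hits_le.
Qed.

Lemma sum_OPT_ge (R : realFieldType) (n : nat) (J A : finType)
    (enc : J * A -> 'I_n) :
  injective enc ->
  #|{ffun J -> A * A}|%:R * #|{ffun 'I_n -> draw J A}|%:R * (#|J| * #|A|)%:R <=
  2 * \sum_rho \sum_(w : {ffun 'I_n -> draw J A}) (OPT (hard_input enc rho w))%:R :> R.
Proof.
move=> encI; rewrite -mulrA -sum_constE mulr_sumr; apply: ler_sum => rho _.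
rewrite -natr_sum -!natrM ler_nat card_ffun card_ord mulnC -card_prod.
have JAn : (#|{: J * A}| <= n)%N by rewrite -[leqRHS]card_ord (leq_card enc).
apply: leq_trans (sum_card_image_ge (@own_fiber J A) JAn) _.
rewrite leq_mul2l /=; apply: leq_sum => w _.
apply: leq_trans (card_image_le_OPT (own_in_hard_input enc rho w)).
rewrite (imset_comp enc (fun i => own (w i))).
by rewrite card_imset.
Qed.

(** The guarantee is summed over all hard inputs and the protocol is averaged over its deterministic
    parts; [C] counts the pairs [(rho, w)] and cancels. *)
Lemma approx_ratio_grid (R : realType) (n l f r : nat) (P : rand_protocol R n l) (c : R) :
  has_approx_ratio P c -> (0 < f)%N -> (0 < r)%N -> (f * r <= n)%N ->
  ((f * r) ^ 2)%:R <= 2 * c * (f * r * (f * 2) + n * (2 * l.+1 * r + 2 * f))%:R.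
Proof.
move=> [c1 ratio] f0 r0 frn.
have c0 : 0 < c by exact: lt_le_trans c1.
have cfr : #|{: 'I_f * 'I_r}| = (f * r)%N by rewrite card_prod !card_ord.
have hfr : (#|{: 'I_f * 'I_r}| <= n)%N by rewrite cfr.
pose enc (z : 'I_f * 'I_r) := widen_ord hfr (enum_rank z).
have encI : injective enc by move=> y z /(congr1 val) /= /val_inj /enum_rank_inj.
have r0' : (0 < #|'I_r|)%N by rewrite card_ord.
pose hard rho (w : {ffun 'I_n -> draw 'I_f 'I_r}) := hard_input enc rho w.
set C : R := #|{ffun 'I_f -> 'I_r * 'I_r}|%:R * #|{ffun 'I_n -> draw 'I_f 'I_r}|%:R.
have C0 : 0 < C.
  rewrite mulr_gt0 // ltr0n.
    by rewrite card_ffun expn_gt0 card_prod card_ord muln_gt0 r0.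
  by rewrite card_ffun expn_gt0 !card_prod !card_ord !muln_gt0 f0 r0 card_ffun expn_gt0 card_bool.
set B := (f * r * (f * 2) + _)%N.
have opt := sum_OPT_ge R encI.
have val p := sum_value_le R p encI r0'.
rewrite !card_ord -/C in opt val.
have le1 : \sum_rho \sum_w (OPT (hard rho w))%:R <=
    c * \sum_p P p * \sum_rho \sum_w (value (hard rho w) (output p (hard rho w)))%:R.
  have -> : \sum_p P p * \sum_rho \sum_w (value (hard rho w) (output p (hard rho w)))%:R =
     \sum_rho \sum_w expected_value P (hard rho w).
    under eq_bigr => p _ do rewrite mulr_sumr.
    rewrite exchange_big /=; apply: eq_bigr => rho _.
    under eq_bigr => p _ do rewrite mulr_sumr.
    by rewrite exchange_big.
  rewrite mulr_sumr; apply: ler_sum => rho _; rewrite mulr_sumr; apply: ler_sum => w _.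
  by have := ratio (hard rho w); rewrite ler_pdivrMr // mulrC.
have le2 : (f * r)%:R * \sum_p P p * \sum_rho \sum_w
    (value (hard rho w) (output p (hard rho w)))%:R <= C * B%:R.
  have <- : \sum_p P p * (C * B%:R) = C * B%:R by rewrite -mulr_suml weight_sum1 mul1r.
  rewrite mulr_sumr; apply: ler_sum => p _.
  by rewrite mulrCA ler_wpM2l ?weight_ge0 ?val.
rewrite -(ler_pM2l C0) natrX expr2 mulrA.
have fr0 : 0 < (f * r)%:R :> R by rewrite ltr0n muln_gt0 f0.
apply: (le_trans (ler_wpM2r (ltW fr0) opt)).
have : (f * r)%:R * (\sum_rho \sum_w (OPT (hard rho w))%:R) <= c * (C * B%:R).
  apply: (le_trans (ler_wpM2l (ltW fr0) le1)).
  by rewrite mulrCA ler_wpM2l // ltW.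
rewrite /hard; lra.
Qed.

(** * Choice of the grid and final estimates *)

Lemma grid_size (R : realType) (n : nat) (y : R) :
  48 <= y -> y <= n%:R ->
  exists f r : nat, [/\ (0 < f)%N, (0 < r)%N, (f * r <= n)%N,
    y / 96 <= f%:R <= y / 48 & n%:R / 2 <= (f * r)%:R :> R].
Proof.
move=> y48 yn; pose f := Num.trunc (y / 48).
have /andP[fy yf] : f%:R <= y / 48 < f.+1%:R by apply: truncn_itv; lra.
rewrite -[f.+1%:R]natr1 in yf.
have f0 : (0 < f)%N by rewrite -(ltr0n R); lra.
have f1 : 1 <= f%:R :> R by rewrite ler1n.
have n0 : 0 <= n%:R :> R by [].
have fn : (f <= n)%N by rewrite -(ler_nat R); lra.
exists f, (n %/ f)%N; split=> //.
- by rewrite divn_gt0.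
- by rewrite mulnC leq_divM.
- by apply/andP; split; lra.
- have := ltn_pmod n f0; have := divn_eq n f; rewrite mulnC.
  move: (f * _)%N (n %% f)%N => N m nE.
  rewrite -(ltr_nat R) => mf.
  have : n%:R = N%:R + m%:R :> R by rewrite -natrD -nE.
  by lra.
Qed.

(** Here [x] is n, [z] is n^alpha, [N] is the grid size and [s] is l + 1. The 48 makes the terms
    quadratic in [f] cost at most [x * f / 4], half of the lower bound [x / 2 * f] on [N * f]. *)
Lemma grid_arith (R : realFieldType) (x y z c f N s : R) :
  0 < x -> 0 < z -> 0 < f -> 0 <= s -> 0 <= c -> c <= z -> z * y = x -> f <= y / 48 ->
  x / 2 <= N -> N ^+ 2 * f <= 2 * c * (N * (f * 2) * f + x * (2 * s * N + 2 * f * f)) ->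
  f <= 16 * (z * s).
Proof.
move=> x0 z0 f0 s0 c0 cz zy fy xN h.
have N0 : 0 < N by lra.
have zf : z * f <= x / 48 by rewrite -zy -mulrA ler_pM2l.
have h1 : N ^+ 2 * f <= N * (2 * z * (6 * f * f + 2 * x * s)).
  apply: (le_trans h).
  have : x * (2 * f * f) <= 4 * N * f * f.
    have -> : x * (2 * f * f) = (2 * x) * (f * f) by ring.
    have -> : 4 * N * f * f = (4 * N) * (f * f) by ring.
    by rewrite ler_pM2r ?mulr_gt0 //; lra.
  move=> h2; have -> : N * (2 * z * (6 * f * f + 2 * x * s)) =
    2 * z * (N * (f * 2) * f + (x * (2 * s * N) + 4 * N * f * f)) by ring.
  have pos : 0 <= N * (f * 2) * f + x * (2 * s * N + 2 * f * f).
    by rewrite addr_ge0 ?mulr_ge0 ?addr_ge0 ?mulr_ge0 // ltW.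
  apply: (le_trans (ler_wpM2r pos (_ : 2 * c <= 2 * z))); first by lra.
  by rewrite ler_pM2l; lra.
move: h1; rewrite expr2 -mulrA ler_pM2l // => h1.
have h3 : x / 2 * f <= N * f by rewrite ler_pM2r.
have h4 : z * f * f <= x / 48 * f by rewrite ler_pM2r.
by rewrite -(ler_pM2l x0); lra.
Qed.

(** 2304 = 48^2 ensures [48 <= y] in the theorem, and 3073 just exceeds 2 * 96 * 16, the product of
    the constants lost there. *)
Lemma large_powers (R : realType) (eps : R) : 0 < eps ->
  exists N : nat, forall n : nat, (N <= n)%N ->
    2304 <= n%:R :> R /\ 3073 <= n%:R `^ (3 / 2 * eps).
Proof.
move=> e0; pose t : R := 3073 `^ (3 / 2 * eps)^-1.
exists (maxn 2304 (Num.bound t)) => n; rewrite geq_max => /andP[n1 n2].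
split; first by rewrite ler_nat.
have t0 : 0 <= t by exact: powR_ge0.
have tn : t <= n%:R.
  by apply/ltW/(lt_le_trans (archi_boundP t0)); rewrite ler_nat.
have a0 : 0 < 3 / 2 * eps by rewrite mulr_gt0 //; lra.
have := @ge0_ler_powR _ _ (ltW a0) t n%:R; rewrite !nnegrE t0 ler0n tn => /(_ isT isT isT).
by rewrite /t -powRrM mulVf ?gt_eqF // powRr1 //; lra.
Qed.

Theorem theorem3p2 (R : realType) (eps alpha : R)
    (heps : 0 < eps) (halpha : alpha <= 2^-1 - eps) :
  exists N : nat, forall n : nat, (N <= n)%N ->
  forall l : nat, l%:R <= n%:R `^ (2^-1 - alpha - eps / 2) ->
  forall (P : rand_protocol R n l) (c : R),
    has_approx_ratio P c -> n%:R `^ alpha <= c.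
Proof.
have [N large] := large_powers heps.
exists N => n /large [n_large n_pow] l hl P c ratio.
have [c1 _] := ratio.
set x : R := n%:R in n_large n_pow hl *.
have x1 : 1 <= x by lra.
(* A nonpositive [alpha] is settled by [1 <= c]; a positive one gives [y <= x]. *)
have [a0|a0] := leP alpha 0.
  by apply: le_trans c1; rewrite -(powRr0 x) ler_powR.
rewrite leNgt; apply/negP => cz.
have x0 : 0 < x by lra.
set z := x `^ alpha in cz.
have z0 : 0 < z by exact: powR_gt0.
have powD s t : x `^ s * x `^ t = x `^ (s + t) by rewrite powRD // (gt_eqF x0) implybT.
pose y := x `^ (1 - alpha).
have zy : z * y = x by rewrite powD subrKC powRr1 // ltW.
have half_y : x `^ 2^-1 <= y by apply: ler_powR => //; lra.
have y48 : 48 <= y.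
  apply: le_trans half_y; rewrite powR12_sqrt; last exact: ltW.
  by rewrite -ler_sqr ?nnegrE ?sqrtr_ge0 // sqr_sqrtr ?(ltW x0) // expr2; lra.
have yx : y <= x by rewrite -[leRHS](powRr1 (ltW x0)); apply: ler_powR => //; lra.
have [f [r [f0 r0 frn /andP[yf fy] fr]]] := grid_size y48 yx.
have small : 3073 * (z * l.+1%:R) <= 2 * y.
  (* The exponent is at least [eps / 2], so the power also bounds the extra 1. *)
  have l1 : l.+1%:R <= 2 * x `^ (2^-1 - alpha - eps / 2).
    rewrite -[l.+1%:R]natr1 mulr_natl mulr2n lerD // -[leLHS](powRr0 x); apply: ler_powR => //; lra.
  have zl : z * l.+1%:R <= 2 * x `^ (2^-1 - eps / 2).
    apply: (le_trans (ler_wpM2l (ltW z0) l1)).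
    by rewrite mulrCA powD (_ : alpha + _ = 2^-1 - eps / 2) //; ring.
  apply: (@le_trans _ _ (x `^ (3 / 2 * eps) * (2 * x `^ (2^-1 - eps / 2)))).
    by apply: ler_pM => //; rewrite mulr_ge0 // ltW.
  rewrite mulrCA powD ler_pM2l //.
  by apply: ler_powR => //; lra.
have s0 : 0 < z * l.+1%:R by rewrite mulr_gt0.
have f0' : 0 < f%:R :> R by rewrite ltr0n.
have : f%:R <= 16 * (z * l.+1%:R).
  apply: (@grid_arith _ x y z c f%:R (f * r)%:R l.+1%:R) => //; [lra|exact: ltW|].
  (* Multiplying by [f] turns the lone factor [r] into [f * r], which [grid_size] controls. *)
  have := approx_ratio_grid ratio f0 r0 frn.
  rewrite natrX -(ler_pM2r f0') => /le_trans; apply.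
  rewrite le_eqVlt; apply/orP; left; apply/eqP.
  rewrite (natrD _ (f * r * (f * 2))) !natrM (natrD _ (2 * l.+1 * r)) !natrM /x.
  ring.
(* Since [y / 96 <= f], the last bound gives [2 * y <= 3072 * (z * l.+1%:R)], against [small]. *)
lra.
Qed.
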